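(* Let $C>0$ and $\alpha>1$ be real numbers. Let the sequence of cutoffs $(K_i)_{i\le n}$ be given by $$K_i=\left\lfloor\left(\frac{4Ci}{\alpha-1}\right)^{1/\alpha}\right\rfloor .$$ Then the expected redundancy of the procedure CensoringCode with these cutoffs on the envelope class $\Lambda_{C\cdot^{-\alpha}}$, that is, $\sup_{P\in\Lambda_{C\cdot^{-\alpha}}}\left(\mathbb{E}_P[L(X_{1:n})]-H(X_{1:n})\right)$ where $L(\mathbf{x})$ is the length of the code produced on input $\mathbf{x}\in\mathbb{N}_+^n$, is not larger than $$\left(\frac{4Cn}{\alpha-1}\right)^{1/\alpha}\log n\,(1+o(1))\qquad (n\to\infty).$$
   Context: Logarithms are in base 2; $\mathbb{N}_+=\{1,2,\dots\}$; $H$ denotes Shannon entropy. $\Lambda_{C\cdot^{-\alpha}}$ is the class of stationary memoryless (i.i.d.) sources $P$ on $\mathbb{N}_+$ with $P\{X_1=k\}\le \min(1,C/k^\alpha)$ for all $k\in\mathbb{N}_+$. CensoringCode. Let $(K_i)_{i\le n}$ be a non-decreasing sequence of non-negative integer cutoffs. For $\mathbf{x}\in\mathbb{N}_+^n$, the symbol $\mathbf{x}_i$ is censored if $\mathbf{x}_i>K_i$. Put $\tilde{\mathbf{x}}_i=\mathbf{x}_i$ if $\mathbf{x}_i\le K_i$ and $\tilde{\mathbf{x}}_i=0$ otherwise, and let $\check{\mathbf{x}}$ be the subsequence of censored symbols. The code of $\mathbf{x}$ is the concatenation of two binary strings $\mathtt{C1}(\mathbf{x})$ and $\mathtt{C2}(\mathbf{x})$,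 so $L(\mathbf{x})=|\mathtt{C1}(\mathbf{x})|+|\mathtt{C2}(\mathbf{x})|$. $\mathtt{C1}(\mathbf{x})$ is the concatenation of the Elias penultimate codewords of the symbols of $\check{\mathbf{x}}$, the codeword of $j\ge1$ having exactly $\ell(j)=\lfloor\log j+2\log(1+\log j)+1\rfloor$ bits. $\mathtt{C2}(\mathbf{x})$ is the arithmetic code of $\tilde{\mathbf{x}}$ given $\check{\mathbf{x}}$, whose length is, up to a quantity smaller than 1, $-\log Q(\tilde{\mathbf{x}}\mid\check{\mathbf{x}})=-\sum_{i=0}^{n-1}\log Q(\tilde{\mathbf{x}}_{i+1}\mid\tilde{\mathbf{x}}_{1:i},\check{\mathbf{x}})$, where for $j\in\{0,\dots,K_{i+1}\}$ $$Q(\tilde X_{i+1}=j\mid\tilde X_{1:i}=\tilde{\mathbf{x}}_{1:i},\check X=\check{\mathbf{x}})=\frac{n_i^j+\frac12}{i+\frac{K_{i+1}+1}{2}};$$ here $n_i^j$ (for $j>0$) is the number of occurrences of $j$ in $\mathbf{x}_{1:i}$, and $n_i^0$ is the number of symbols of $\mathbf{x}_{1:i}$ larger than $K_{i+1}$. *)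

(* Defs.v *)
From HB Require Import structures.
From mathcomp Require Export all_boot all_order all_algebra.
From mathcomp Require Export all_classical all_reals all_analysis.
Export Order.TTheory GRing.Theory Num.Theory.
Export numFieldNormedType.Exports.

Set Implicit Arguments.
Unset Strict Implicit.
Unset Printing Implicit Defensive.

#[export] Set Implicit Arguments.
#[export] Unset Strict Implicit.
#[export] Unset Printing Implicit Defensive.

Local Open Scope classical_set_scope.
Local Open Scope ring_scope.

Record Nplus := MkNplus { nat_of_Nplus :> nat; _ : (0 < nat_of_Nplus)%N }.
HB.instance Definition _ := [isSub for nat_of_Nplus].
HB.instance Definition _ := [Countable of Nplus by <:].
HB.instance Definition _ := isPointed.Build Nplus (@MkNplus 1 isT).

Definition log2 (R : realType) (x : R) : R := ln x / ln 2.

(** Letters are indexed from 0: [w i] is the letter X_(i+1) of the path [w],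
    and [tnth x i] is the letter x_(i+1) of the message [x].  Cutoffs keep
    their usual indices, so the letter of index [i] is compared to [K i.+1]. *)

Definition cylinders : set (set (nat -> Nplus)) :=
  [set A | exists i (k : Nplus), A = [set w | w i = k]].

Definition paths := g_sigma_algebraType cylinders.

Definition message (n : nat) (w : paths) : n.-tuple Nplus :=
  [tuple w i | i < n].

Section sources.
Variables (R : realType) (P : probability paths R).

Definition first_pmf (k : Nplus) : R := fine (P [set w | w 0%N = k]).

Definition joint_pmf (n : nat) (x : n.-tuple Nplus) : R :=
  fine (P [set w | message n w = x]).

Definition stationary_memoryless :=
  forall (n : nat) (x : n.-tuple Nplus),
    joint_pmf x = \prod_(i < n) first_pmf (tnth x i).

Definition joint_entropy (n : nat) : \bar R :=
  (\esum_(x in [set: n.-tuple Nplus])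
     (- (joint_pmf x * log2 (joint_pmf x)))%:E)%E.

End sources.

Definition power_envelope_class (R : realType) (C alpha : R) :
    set (probability paths R) :=
  [set P | stationary_memoryless P /\
     forall k : Nplus, first_pmf P k <= Num.min 1 (C / (k%:R `^ alpha))].

Section censoring_code.
Variables (R : realType) (K : nat -> nat) (n : nat).
Implicit Types x : n.-tuple Nplus.

Definition censored_symbols x : seq Nplus :=
  [seq tnth x i | i : 'I_n <- enum 'I_n & (K i.+1 < tnth x i)%N].

Definition censor x (i : 'I_n) : nat :=
  if (tnth x i <= K i.+1)%N then (tnth x i : nat) else 0%N.

(** The number n_i^j of the i letters preceding x_(i+1).  For j = 0 these
    are compared to the current cutoff K_(i+1), not to the cutoffs under which
    they were themselves encoded. *)
Definition past_count x (i : 'I_n) (j : nat) : nat :=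
  if j == 0%N then #|[pred l : 'I_n | (l < i)%N && (K i.+1 < tnth x l)%N]|
  else #|[pred l : 'I_n | (l < i)%N && (tnth x l == j :> nat)]|.

(** The conditional probability of j in {0, ..., K_(i+1)} given the first i
    censored letters and the subsequence of censored symbols; together these
    determine x_1, ..., x_i, hence the counts. *)
Definition coding_prob x (i : 'I_n) (j : nat) : R :=
  ((past_count x i j)%:R + 2^-1) / (i%:R + ((K i.+1).+1)%:R / 2).

Definition ideal_length x : R :=
  - \sum_(i < n) log2 (coding_prob x i (censor x i)).

Definition censoring_code (elias : Nplus -> seq bool)
    (arith : n.-tuple Nplus -> seq bool) x : seq bool :=
  flatten [seq elias k | k <- censored_symbols x] ++ arith x.

End censoring_code.

(** The codes used for the two parts enter only through their codeword
    lengths, so they are characterised by these lengths. *)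

Definition elias_length (R : realType) (j : nat) : nat :=
  Num.truncn (log2 (j%:R : R) + 2 * log2 (1 + log2 (j%:R : R)) + 1).

Definition has_elias_lengths (R : realType) (elias : Nplus -> seq bool) :=
  forall j : Nplus, size (elias j) = elias_length R j.

Definition has_arithmetic_lengths (R : realType) (K : nat -> nat)
    (arith : forall n, n.-tuple Nplus -> seq bool) :=
  forall n (x : n.-tuple Nplus),
    `|(size (arith n x))%:R - ideal_length R K x| < 1.

(** The joint entropy may be subtracted in the extended reals: it is finite
    for every source of the class when [1 < alpha]. *)
Definition expected_redundancy (R : realType) (n : nat)
    (code : n.-tuple Nplus -> seq bool) (P : probability paths R) : \bar R :=
  ('E_P[fun w => (size (code (message n w)))%:R] - joint_entropy P n)%E.

Definition class_redundancy (R : realType) (n : nat)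
    (code : n.-tuple Nplus -> seq bool) (Lambda : set (probability paths R)) :
    \bar R :=
  ereal_sup [set expected_redundancy code P | P in Lambda].

Definition power_cutoff (R : realType) (C alpha : R) (i : nat) : nat :=
  Num.truncn ((4 * C * i%:R / (alpha - 1)) `^ alpha^-1).

(* Main.v *)
Require Import Defs.
From mathcomp Require Import measurable_realfun ring lra.

Local Open Scope classical_set_scope.
Local Open Scope ring_scope.

(** Write lambda = 4 C / (alpha - 1), a_i = (lambda i)^(1/alpha), so that the
    cutoff K_i is the integer part of a_i, and let p be the law of one letter.
    Call the class of a letter k at cutoff K the letter itself when k <= K and
    the set of all letters above K otherwise.  The redundancy splits,
    letter by letter, into two parts.

    Mixture part.  The probability of a message is at most the product of the
    probabilities of the classes of its letters, so [- log2] of that product is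
    at most [- log2] of the probability of the message, whose mean is the
    entropy.  It remains to bound the mean excess of [- log2 Q] over [- log2] of
    the class probability.  The i letters before the current one are
    independent of it, and the count N of a class of probability r among them
    is binomial.  With [ln z <= z - 1] (a linear substitute for Jensen's
    inequality) the excess is controlled by the mean of
    (i + 1) r / (N + 1/2) - 1, and the absorption identity of binomial
    coefficients shows that this mean, weighted by r, is at most
    2 / (i + 2) per class ([binomial_mean_inv_half]).  Summed over the
    K + 1 classes and the n letters this gives a constant times the sum of
    (K_i + 1) / i, that is O(n^(1/alpha)), with no logarithm.

    Censored part.  An Elias codeword of k has at most 2 log2 k + 5 bits, and
    the envelope makes the mean length spent on a letter above a_i at most
    about C (2 log2 a_n) a_i^(1 - alpha) / (alpha - 1)
    ([censored_elias_mean_le]).  Since C / (alpha - 1) = lambda / 4, the sum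
    over i <= n of these terms is (1/2) a_n log2 n + O(a_n), and the boundary
    terms left out above are negligible.

    Altogether the redundancy is at most (1/2) a_n log2 n + O(a_n), uniformly
    over the class, which is eventually below a_n log2 n: the vanishing
    sequence of the theorem can be taken to be zero. *)

(** * Means over messages as sums over words *)

Lemma esumZl (R : realType) (T : choiceType) (c : R) (a : T -> \bar R) :
  0 <= c -> (forall t, (0 <= a t)%E) ->
  (\esum_(t in [set: T]) (c%:E * a t) = c%:E * \esum_(t in [set: T]) a t)%E.
Proof.
move=> c0 a0.
have le_scaled (b : R) (f : T -> \bar R) : 0 <= b -> (forall t, (0 <= f t)%E) ->
    (\esum_(t in [set: T]) (b%:E * f t) <= b%:E * \esum_(t in [set: T]) f t)%E.
  move=> b0 f0; apply: ge_ereal_sup => _ [X [finX XT] <-].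
  rewrite fsbig_finite//= -ge0_sume_distrr; last by move=> t _; exact: f0.
  apply: lee_wpmul2l; first by rewrite lee_fin.
  by apply: ereal_sup_ubound; exists X => //; rewrite fsbig_finite.
apply/eqP; rewrite eq_le le_scaled//=.
have [->|cn0] := eqVneq c 0.
  by rewrite mul0e; apply: esum_ge0 => t _; rewrite mul0e.
have cgt0 : 0 < c by rewrite lt_def cn0.
rewrite (_ : (\esum_(t in [set: T]) a t)%E =
             \esum_(t in [set: T]) (c^-1%:E * (c%:E * a t))%E); last first.
  by apply: eq_esum => t _; rewrite muleA -EFinM mulVf// mul1e.
have := le_scaled c^-1 (fun t => c%:E * a t)%E.
move/(_ _ _)/(lee_wpmul2l (x := c%:E)) => h.
apply: le_trans (h _ _ _) _ => //.
- by rewrite invr_ge0.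
- by move=> t; rewrite mule_ge0.
- by rewrite muleA -EFinM mulfV// mul1e.
Qed.

(** A countable-valued [X] is measurable as soon as its fibres are, whatever is
    put on its range, and the integral splits along these fibres.  Enumerating
    them by [pickle] reduces the claim to countable additivity. *)
Lemma integral_discrete d (T : measurableType d) (R : realType)
    (mu : {measure set T -> \bar R}) (I : countType) (X : T -> I)
    (f : I -> \bar R) :
  (forall i, measurable (X @^-1` [set i])) -> (forall i, (0 <= f i)%E) ->
  (\int[mu]_t f (X t) =
     \esum_(i in [set: I]) (f i * mu (X @^-1` [set i])))%E.
Proof.
move=> mX f0.
(* every preimage is a countable union of fibres *)
have mXB (B : set I) : measurable (X @^-1` B).
  rewrite (_ : X @^-1` B = \bigcup_i (X @^-1` (B `&` [set i]))).
    apply: countable_bigcupT_measurable; first exact: countableP.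
    move=> i; have [Bi|nBi] := pselect (B i).
      by rewrite setIC setIidl ?mX// => _ ->.
    rewrite (_ : B `&` [set i] = set0) ?preimage_set0//.
    by apply/seteqP; split=> // j [Bj ji]; apply: nBi; rewrite -ji.
  by apply/seteqP; split=> [t Bt|t [i _ []]//]; exists (X t).
have mf : measurable_fun setT (f \o X).
  by move=> _ B mB; rewrite setTI comp_preimage; exact: mXB.
(* [pickle] need not be onto, so a code class is a singleton or empty *)
pose code_class n := [set i : I | pickle i = n].
have trivc : trivIset setT code_class.
  by move=> a b _ _ [i [/= <- <-]].
have cupc : \bigcup_n code_class n = setT.
  by apply/seteqP; split=> // i _; exists (pickle i).
rewrite -[in LHS](preimage_setT X) -cupc preimage_bigcup.
rewrite ge0_integral_bigcup//; last 2 first.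
- exact: measurable_funS mf.
- by move=> a b _ _ [t [/= <- <-]].
rewrite nneseries_sum_bigcup//; last first.
  by move=> i; rewrite mule_ge0.
apply: eq_eseriesr => n _.
have [[i in_]|nex] := pselect (exists i : I, pickle i = n).
  have -> : code_class n = [set i].
    apply/seteqP; split=> [j /= jn|_ ->//].
    by apply: (pcan_inj pickleK); rewrite jn in_.
  rewrite esum_set1 ?mule_ge0// -integral_cst//.
  by apply: eq_integral => t; rewrite inE => /= ->.
have -> : code_class n = set0.
  by apply/seteqP; split=> // j jn; apply: nex; exists j.
by rewrite preimage_set0 integral_set0 esum_set0.
Qed.

Lemma message_measurable n (x : n.-tuple Nplus) :
  measurable [set w : paths | message n w = x].
Proof.
rewrite (_ : [set w | _] =
    \bigcap_(i in [set: 'I_n]) [set w : paths | w i = tnth x i]).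
  apply: fin_bigcap_measurable => [|i _]; first exact: finite_finset.
  by apply: sub_sigma_algebra; exists i, (tnth x i).
apply/seteqP; split=> [w /= <- i _ /=|w /= h].
  by rewrite tnth_mktuple.
by apply: eq_from_tnth => i; rewrite tnth_mktuple; exact: h.
Qed.

Lemma expectation_message (R : realType) (P : probability paths R) n
    (f : n.-tuple Nplus -> R) : (forall x, 0 <= f x) ->
  ('E_P[fun w => f (message n w)] =
     \esum_(x in [set: n.-tuple Nplus]) ((joint_pmf P x)%:E * (f x)%:E))%E.
Proof.
move=> f0; rewrite unlock (integral_discrete P (f := fun x => (f x)%:E)).
- apply: eq_esum => x _; rewrite muleC /joint_pmf fineK//.
  by rewrite fin_num_measure//; exact: message_measurable.
- exact: message_measurable.
- by move=> x; rewrite lee_fin.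
Qed.

(** * Inverse moments of the binomial law *)

Section binomial_mean.
Variables (R : realType) (p : R).
Hypotheses (p_ge0 : 0 <= p) (p_le1 : p <= 1).

(** The mean of [phi N] for N binomial of parameters [i] and [p], computed by
    conditioning on the first trial; this is the recursion that the means over
    words satisfy. *)
Fixpoint binomial_mean (i : nat) (phi : nat -> R) : R :=
  if i is j.+1 then
    p * binomial_mean j (fun c => phi c.+1) + (1 - p) * binomial_mean j phi
  else phi 0%N.

Lemma le_binomial_mean i (phi psi : nat -> R) :
  (forall c, phi c <= psi c) -> binomial_mean i phi <= binomial_mean i psi.
Proof.
elim: i phi psi => [|i IH] phi psi h /=; first exact: h.
by rewrite lerD// ler_wpM2l ?subr_ge0//; apply: IH.
Qed.

Lemma binomial_mean_cst i (a : R) : binomial_mean i (fun=> a) = a.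
Proof. by elim: i => [//|i IH] /=; rewrite IH; ring. Qed.

Lemma binomial_meanD i (phi psi : nat -> R) :
  binomial_mean i (fun c => phi c + psi c) =
  binomial_mean i phi + binomial_mean i psi.
Proof. by elim: i phi psi => [//|i IH] phi psi /=; rewrite !IH; ring. Qed.

Lemma binomial_meanZ i (a : R) (phi : nat -> R) :
  binomial_mean i (fun c => a * phi c) = a * binomial_mean i phi.
Proof. by elim: i phi => [//|i IH] phi /=; rewrite !IH; ring. Qed.

(** The identity (c + 1) C(i + 1, c + 1) = (i + 1) C(i, c) read on means. *)
Lemma binomial_mean_absorption i (phi : nat -> R) :
  i.+1%:R * p * binomial_mean i (fun c => phi c.+1) =
  binomial_mean i.+1 (fun c => c%:R * phi c).
Proof.
elim: i phi => [|i IH] phi; first by rewrite /= mul1r mul0r mulr0 addr0 mul1r.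
rewrite [RHS](_ : _ = p * binomial_mean i.+1 (fun c => c.+1%:R * phi c.+1) +
   (1 - p) * binomial_mean i.+1 (fun c => c%:R * phi c))//.
rewrite -IH.
rewrite (_ : (fun c => c.+1%:R * phi c.+1) =
             (fun c => c%:R * phi c.+1 + phi c.+1)); last first.
  by apply/funext => c; rewrite -(addn1 c) natrD mulrDl mul1r.
rewrite binomial_meanD -(IH (fun c => phi c.+1)).
by rewrite /= -(addn1 i.+1) -(addn1 i) !natrD; ring.
Qed.

(** By absorption the left-hand side is the probability that a binomial variable
    of size [i.+1] is positive. *)
Lemma binomial_mean_inv i :
  i.+1%:R * p * binomial_mean i (fun c => c.+1%:R^-1) <= 1.
Proof.
rewrite (binomial_mean_absorption _ (fun c => c%:R^-1)).
rewrite -[leRHS](binomial_mean_cst i.+1); apply: le_binomial_mean => c.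
by have [->|c0] := eqVneq (c%:R : R) 0; rewrite ?mul0r// mulfV.
Qed.

Lemma binomial_mean_inv2 i :
  i.+1%:R * i.+2%:R * p ^+ 2 *
    binomial_mean i (fun c => (c.+1%:R * c.+2%:R)^-1) <= 1.
Proof.
apply: le_trans (binomial_mean_inv i.+1).
rewrite (_ : _ * _ * _ * _ = i.+2%:R * p * (i.+1%:R * p *
    binomial_mean i (fun c => (c.+1%:R * c.+2%:R)^-1))); last by ring.
rewrite (binomial_mean_absorption _ (fun c => (c%:R * c.+1%:R)^-1)).
rewrite ler_wpM2l ?mulr_ge0//; apply: le_binomial_mean => c.
have [->|c0] := eqVneq (c%:R : R) 0; first by rewrite mul0r invr_ge0.
by rewrite invfM mulrA mulfV// mul1r.
Qed.

(** The elementary bound 1 / (c + 1/2) <= 1 / (c + 1) + 2 / ((c + 1) (c + 2))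
    reduces the half-integer shift of the estimator to the two means that
    absorption evaluates.  The leading coefficient 1 of [p] is what keeps the
    redundancy per letter of order 1 / i. *)
Lemma binomial_mean_inv_half i :
  i.+1%:R * p ^+ 2 * binomial_mean i (fun c => (c%:R + 2^-1)^-1) <=
  p + 2 / i.+2%:R.
Proof.
have h c : (c%:R + 2^-1 : R)^-1 <= c.+1%:R^-1 + 2 * (c.+1%:R * c.+2%:R)^-1.
  rewrite -(addn1 c.+1) -(addn1 c) !natrD.
  have : 0 <= c%:R :> R by [].
  move: (c%:R : R) => x x0.
  rewrite [leRHS](_ : _ = (x + 4) / ((x + 1) * (x + 1 + 1))); last first.
    by field; rewrite !gt_eqF; lra.
  rewrite ler_pdivlMr; last by nra.
  rewrite mulrC ler_pdivrMr; nra.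
apply: le_trans (_ : i.+1%:R * p ^+ 2 * binomial_mean i
   (fun c => c.+1%:R^-1 + 2 * (c.+1%:R * c.+2%:R)^-1) <= _).
  by rewrite ler_wpM2l ?mulr_ge0 ?sqr_ge0//; exact: le_binomial_mean.
rewrite binomial_meanD binomial_meanZ mulrDr lerD//.
  have := binomial_mean_inv i => /(ler_wpM2l p_ge0).
  rewrite mulr1; apply: le_trans.
  by rewrite le_eqVlt; apply/orP; left; apply/eqP; ring.
rewrite ler_pdivlMr//.
have := binomial_mean_inv2 i => /(ler_wpM2l (ler0n R 2)).
rewrite mulr1; apply: le_trans.
by rewrite le_eqVlt; apply/orP; left; apply/eqP; ring.
Qed.

End binomial_mean.

(** * Independent letters *)

Section iid_mean.
Variables (R : realType) (T : countType) (p : T -> R).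
Hypothesis p_ge0 : forall t, 0 <= p t.
Hypothesis p_sum1 : (\esum_(t in [set: T]) (p t)%:E = 1)%E.

Definition word_pmf n (x : n.-tuple T) : R := \prod_(i < n) p (tnth x i).

(** The integrand is defined on sequences of any length, so that the first
    letter can be split off. *)
Definition iid_mean n (F : seq T -> \bar R) : \bar R :=
  (\esum_(x in [set: n.-tuple T]) ((word_pmf x)%:E * F x))%E.

Lemma word_pmf_ge0 n (x : n.-tuple T) : 0 <= word_pmf x.
Proof. exact: prodr_ge0. Qed.

Lemma word_pmf_cons n t (x : n.-tuple T) :
  word_pmf [tuple of t :: x] = p t * word_pmf x.
Proof.
rewrite /word_pmf big_ord_recl tnth0; congr (_ * _).
by apply: eq_bigr => i _; rewrite tnthS.
Qed.

Lemma iid_mean_cons n (F : seq T -> \bar R) : (forall s, (0 <= F s)%E) ->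
  (iid_mean n.+1 F =
     \esum_(t in [set: T]) ((p t)%:E * iid_mean n (fun s => F (t :: s))))%E.
Proof.
move=> F0.
transitivity (\esum_(t in [set: T]) \esum_(x in [set: n.-tuple T])
    ((p t)%:E * ((word_pmf x)%:E * F (t :: x))))%E; last first.
  apply: eq_esum => t _; rewrite esumZl// => x.
  by rewrite mule_ge0// lee_fin word_pmf_ge0.
rewrite esum_esum; last first.
  by move=> t x _ _; rewrite !mule_ge0// lee_fin ?word_pmf_ge0.
rewrite /iid_mean (reindex_esum ([set: T] `*`` (fun=> [set: n.-tuple T])) _
  (fun z => [tuple of z.1 :: z.2])).
  by apply: eq_esum => z _; rewrite word_pmf_cons EFinM muleA.
split=> //.
- by move=> [t x] [u y] _ _ /= /(congr1 val)[-> /val_inj ->].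
- by move=> x _; case/tupleP: x => t x; exists (t, x).
Qed.

Lemma iid_mean0 (F : seq T -> \bar R) : (0 <= F [::])%E ->
  iid_mean 0 F = F [::].
Proof.
move=> F0; rewrite /iid_mean (_ : [set: 0.-tuple T] = [set [tuple]]); last first.
  by apply/seteqP; split=> // x _; exact: tuple0.
by rewrite esum_set1 /word_pmf big_ord0 mul1e.
Qed.

Lemma letter_mean_cst (c : \bar R) : (0 <= c)%E ->
  (\esum_(t in [set: T]) ((p t)%:E * c) = c)%E.
Proof.
case: c => [c c0||//].
  under eq_esum do rewrite muleC.
  by rewrite esumZl// p_sum1 mule1.
move=> _; have [t pt] : exists t, p t != 0.
  apply: contrapT => /forallNP h; have := p_sum1.
  rewrite esum1 => [/eqP|t _]; first by rewrite eqe eq_sym oner_eq0.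
  by have /negP := h t; rewrite negbK => /eqP ->.
apply/eqP; rewrite -leye_eq; apply: esum_ge; exists [set t] => //.
by rewrite fsbig_set1 gt0_muley// lte_fin lt_def pt p_ge0.
Qed.

Lemma iid_mean_cst n (c : \bar R) : (0 <= c)%E -> iid_mean n (fun=> c) = c.
Proof.
move=> c0; elim: n => [|n IH]; first exact: iid_mean0.
rewrite iid_mean_cons//; under eq_esum do rewrite IH.
exact: letter_mean_cst.
Qed.

Lemma iid_meanD n (F G : seq T -> \bar R) :
  (forall s, (0 <= F s)%E) -> (forall s, (0 <= G s)%E) ->
  (iid_mean n (fun s => F s + G s) = iid_mean n F + iid_mean n G)%E.
Proof.
move=> F0 G0; rewrite -esumD; last 2 first.
- by move=> x _; rewrite mule_ge0// lee_fin word_pmf_ge0.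
- by move=> x _; rewrite mule_ge0// lee_fin word_pmf_ge0.
by apply: eq_esum => x _; rewrite ge0_muleDr.
Qed.

Lemma iid_mean_sum n (I : choiceType) (r : seq I) (F : I -> seq T -> \bar R) :
  (forall i s, (0 <= F i s)%E) ->
  (iid_mean n (fun s => \sum_(i <- r) F i s) =
   \sum_(i <- r) iid_mean n (F i))%E.
Proof.
move=> F0; rewrite -esum_sum; last first.
  by move=> x i _ _; rewrite mule_ge0// lee_fin word_pmf_ge0.
by apply: eq_esum => x _; rewrite ge0_sume_distrr.
Qed.

Lemma iid_meanZ n (c : R) (F : seq T -> \bar R) :
  0 <= c -> (forall s, (0 <= F s)%E) ->
  (iid_mean n (fun s => c%:E * F s) = c%:E * iid_mean n F)%E.
Proof.
move=> c0 F0; rewrite -esumZl//; last first.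
  by move=> x; rewrite mule_ge0// lee_fin word_pmf_ge0.
by apply: eq_esum => x _; rewrite muleCA.
Qed.

Variable t0 : T.

Lemma iid_mean_nth n i (f : T -> \bar R) : (forall t, (0 <= f t)%E) ->
  (i < n)%N ->
  (iid_mean n (fun s => f (nth t0 s i)) =
     \esum_(t in [set: T]) ((p t)%:E * f t))%E.
Proof.
move=> f0; elim: n i => [//|n IH] [|i] lt_in; rewrite iid_mean_cons//=.
  by apply: eq_esum => t _; rewrite iid_mean_cst.
by under eq_esum do rewrite IH//; rewrite letter_mean_cst// esum_ge0// => t _;
  rewrite mule_ge0// lee_fin.
Qed.

Definition letter_prob (A : pred T) : R :=
  fine (\esum_(t in [set: T]) (p t * (A t)%:R)%:E)%E.

Lemma letter_prob_bounded (A : pred T) :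
  (0 <= \esum_(t in [set: T]) (p t * (A t)%:R)%:E <= 1)%E.
Proof.
rewrite esum_ge0/=; last by move=> t _; rewrite lee_fin mulr_ge0.
rewrite -p_sum1; apply: le_esum => t _; rewrite lee_fin.
by case: (A t); rewrite ?mulr1 ?mulr0.
Qed.

Lemma letter_probE (A : pred T) :
  ((letter_prob A)%:E = \esum_(t in [set: T]) (p t * (A t)%:R)%:E)%E.
Proof.
have /andP[h0 h1] := letter_prob_bounded A; rewrite fineK// fin_numE.
by apply/andP; split; apply/eqP => h; rewrite h in h0 h1.
Qed.

Lemma letter_prob_ge0 (A : pred T) : 0 <= letter_prob A.
Proof. by rewrite -lee_fin letter_probE; have /andP[] := letter_prob_bounded A. Qed.

Lemma letter_prob_le1 (A : pred T) : letter_prob A <= 1.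
Proof. by rewrite -lee_fin letter_probE; have /andP[] := letter_prob_bounded A. Qed.

Lemma le_letter_prob (A : pred T) t : A t -> p t <= letter_prob A.
Proof.
move=> At; rewrite -lee_fin letter_probE; apply: esum_ge; exists [set t] => //.
by rewrite fsbig_set1 At mulr1.
Qed.

Lemma letter_mean_split (A : pred T) (a b : R) : 0 <= a -> 0 <= b ->
  (\esum_(t in [set: T]) ((p t)%:E * (if A t then a else b)%:E) =
     (letter_prob A * a + (1 - letter_prob A) * b)%:E)%E.
Proof.
move=> a0 b0.
have -> : (1 - letter_prob A) = letter_prob (fun t => ~~ A t).
  apply/eqP; rewrite subr_eq eq_sym; apply/eqP/EFin_inj.
  rewrite EFinD !letter_probE -esumD; last 2 first.
  - by move=> t _; rewrite lee_fin mulr_ge0.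
  - by move=> t _; rewrite lee_fin mulr_ge0.
  rewrite -p_sum1; apply: eq_esum => t _; rewrite -EFinD.
  by case: (A t); rewrite /= mulr1 mulr0 ?addr0 ?add0r.
rewrite EFinD !(mulrC (letter_prob _)) !(EFinM _ (letter_prob _)) !letter_probE.
rewrite -!esumZl//; try by move=> t; rewrite lee_fin mulr_ge0.
rewrite -esumD; try by move=> t _; rewrite -EFinM lee_fin !mulr_ge0.
apply: eq_esum => t _; rewrite -!EFinM -EFinD.
by case: (A t); rewrite /= !(mulr1, mulr0) ?addr0 ?add0r mulrC.
Qed.

(** The current letter is independent of the previous ones, and the number of
    those that belong to [A] is binomial.  Splitting off the first letter gives
    exactly the recursion of [binomial_mean]. *)
Lemma iid_mean_count n i (A : pred T) (phi : nat -> R) :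
  (forall c, 0 <= phi c) -> (i < n)%N ->
  iid_mean n (fun s => ((A (nth t0 s i))%:R * phi (count A (take i s)))%:E) =
  (letter_prob A * binomial_mean (letter_prob A) i phi)%:E.
Proof.
elim: i n phi => [|i IH] [//|n] phi phi0 lt_in.
  rewrite (_ : (fun s => _) =
    (fun s => ((A (nth t0 s 0))%:R * phi 0%N)%:E)); last first.
    by apply/funext => s; rewrite take0.
  rewrite (@iid_mean_nth n.+1 0 (fun t => ((A t)%:R * phi 0%N)%:E))//; last first.
    by move=> t; rewrite lee_fin mulr_ge0.
  rewrite -[RHS]/((letter_prob A * phi 0%N)%:E).
  rewrite -[in RHS](addr0 (_ * _)) -(mulr0 (1 - letter_prob A)).
  rewrite -letter_mean_split//; apply: eq_esum => t _; congr (_ * _%:E)%E.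
  by case: (A t); rewrite ?mul1r ?mul0r.
rewrite iid_mean_cons => [|s]; last by rewrite lee_fin mulr_ge0.
have bm_ge0 psi : (forall c, 0 <= psi c) -> 0 <= binomial_mean (letter_prob A) i psi.
  move=> psi0; rewrite -(binomial_mean_cst (letter_prob A) i 0).
  by apply: le_binomial_mean => //; rewrite ?letter_prob_ge0 ?letter_prob_le1.
rewrite /= mulrDr mulrCA (mulrCA _ (1 - _)) -letter_mean_split//; last 2 first.
- by rewrite mulr_ge0 ?letter_prob_ge0// bm_ge0.
- by rewrite mulr_ge0 ?letter_prob_ge0// bm_ge0.
apply: eq_esum => t _; congr (_ * _)%E.
by case: (A t); rewrite -(IH n)//.
Qed.

End iid_mean.

(** * Letter classes and the cost of one letter *)

Lemma ln_le_subr1 (R : realType) (z : R) : 0 < z -> ln z <= z - 1.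
Proof. by move=> z0; have := @le_ln1Dx R (z - 1); rewrite subrKC; apply; lra. Qed.

Lemma first_pmf_ge0 (R : realType) (P : probability paths R) k :
  0 <= first_pmf P k.
Proof. by rewrite fine_ge0. Qed.

Lemma first_pmf_sum1 (R : realType) (P : probability paths R) :
  (\esum_(k in [set: Nplus]) (first_pmf P k)%:E = 1)%E.
Proof.
have m0 (k : Nplus) : measurable [set w : paths | w 0%N = k].
  by apply: sub_sigma_algebra; exists 0%N, k.
rewrite -(@probability_setT _ _ _ P) -[RHS]mul1e -integral_cst//.
rewrite (integral_discrete P (X := fun w : paths => w 0%N) (f := fun=> 1%E))//.
apply: eq_esum => k _; rewrite mul1e /first_pmf fineK//.
by rewrite fin_num_measure//; exact: m0.
Qed.

Lemma count_take (T : eqType) (t0 : T) (A : pred T) n (x : n.-tuple T) i :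
  (i <= n)%N ->
  #|[pred l : 'I_n | (l < i)%N && A (tnth x l)]| = count A (take i x).
Proof.
move=> le_in; rewrite -sum1_card -sum1_count (big_nth t0) size_takel ?size_tuple//.
rewrite big_mkord.
rewrite (big_ord_widen_cond n (fun l => A (nth t0 (take i x) l)) (fun=> 1%N))//.
apply: eq_bigl => l; rewrite inE /= andbC.
by case: (ltnP l i) => li; rewrite ?andbF// nth_take// -tnth_nth.
Qed.

Definition censor_letter (K : nat) (k : Nplus) : nat :=
  if (k <= K)%N then (k : nat) else 0%N.

Definition censor_class (K j : nat) : pred Nplus :=
  fun k => censor_letter K k == j.

(** Counting the earlier censored letters against the current cutoff is what
    makes every count, also the one with index 0, the count of a fixed class of
    letters, hence a binomial variable. *)
Lemma past_count_censor K n (x : n.-tuple Nplus) (i : 'I_n) :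
  past_count K x i (censor K x i) =
  count (censor_class (K i.+1) (censor_letter (K i.+1) (tnth x i))) (take i x).
Proof.
rewrite -(count_take point) ?(ltnW (ltn_ord i))//.
rewrite /past_count /censor -/(censor_letter (K i.+1) (tnth x i)).
have Npos (k : Nplus) : (0 < k)%N by case: k.
case: ifP => [/eqP ->|/negbT j0]; apply: eq_card => l; rewrite !inE /=; congr (_ && _).
  rewrite /censor_class /censor_letter.
  by case: leqP => //; rewrite eqn0Ngt Npos.
rewrite /censor_class; move: j0; rewrite /censor_letter.
case: (leqP (tnth x i)) => // le_iK i0.
case: (leqP (tnth x l)) => // lt_Kl.
by rewrite gtn_eqF ?(leq_ltn_trans le_iK)// ltn_eqF ?Npos.
Qed.

Lemma sum_censor_class_prob (R : realType) (p : Nplus -> R) (K m : nat) :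
  (forall k, 0 <= p k) -> (\esum_(k in [set: Nplus]) (p k)%:E = 1)%E ->
  \sum_(j < m) letter_prob p (censor_class K j) <= 1.
Proof.
move=> p0 p1; rewrite -lee_fin -sumEFin.
under eq_bigr do rewrite letter_probE//.
rewrite -esum_sum; last by move=> k j _ _; rewrite lee_fin mulr_ge0.
rewrite -p1; apply: le_esum => k _; rewrite sumEFin lee_fin -mulr_sumr.
rewrite -[leRHS]mulr1 ler_wpM2l// -natr_sum lern1.
have [lt_jm|le_mj] := ltnP (censor_letter K k) m.
  rewrite (bigD1 (Ordinal lt_jm))//= big1 ?addn0 ?leq_b1// => j /eqP nj.
  by rewrite /censor_class; case: eqP => // e; case: nj; apply: val_inj; rewrite /= e.
rewrite big1// => j _; rewrite /censor_class; case: eqP => // e.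
by have := ltn_ord j; rewrite -e ltnNge le_mj.
Qed.

(** Both logarithms of quotients are replaced by their tangents at 1: the one of
    [(i + (K + 1) / 2) / (i + 1)] and the one of [(i + 1) r / (N + 1/2)].
    Linearising rather than applying Jensen's inequality keeps the bound
    additive, so that means can be taken term by term. *)
Lemma ideal_step_le (R : realType) (i K N : nat) (q r : R) :
  0 < q -> q <= r ->
  - ln ((N%:R + 2^-1) / (i%:R + K.+1%:R / 2)) + 1 <=
  - ln q + (K.+1%:R / 2 / i.+1%:R + i.+1%:R * r / (N%:R + 2^-1)).
Proof.
move=> q0 qr; have r0 := lt_le_trans q0 qr.
have i0 : 0 < i.+1%:R :> R by rewrite ltr0n.
have N0 : 0 < N%:R + 2^-1 :> R by rewrite ltr_wpDl ?invr_gt0.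
have K0 : 0 < K.+1%:R / 2 :> R by rewrite divr_gt0 ?ltr0n.
have D0 : 0 < i%:R + K.+1%:R / 2 :> R by rewrite ltr_wpDl.
have lnqr : ln q <= ln r by rewrite ler_ln ?posrE.
have h1 := ln_le_subr1 (divr_gt0 D0 i0).
have h2 := ln_le_subr1 (divr_gt0 (mulr_gt0 i0 r0) N0).
rewrite !ln_div ?lnM ?posrE ?mulr_gt0// in h1 h2 *.
have : (i%:R + K.+1%:R / 2) / i.+1%:R - 1 <= K.+1%:R / 2 / i.+1%:R :> R.
  rewrite mulrDl lerBlDr addrC lerD2l ler_pdivrMr// mul1r ler_nat//.
move: h1 h2 lnqr.
move: (ln _) (ln i.+1%:R) (ln r) (ln (N%:R + _)) (ln q) => lD li lr lN lq.
move: (_ / i.+1%:R) (i.+1%:R * r / _) (K.+1%:R / 2 / _) => a b c.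
by lra.
Qed.

(** * A redundancy bound for arbitrary cutoffs *)

Lemma ln2_gt0 (R : realType) : 0 < ln 2 :> R.
Proof. by rewrite ln_gt0// ltr1n. Qed.

Lemma size_censoring_code (K : nat -> nat) n (elias : Nplus -> seq bool)
    (arith : n.-tuple Nplus -> seq bool) (x : n.-tuple Nplus) :
  size (censoring_code K elias arith x) =
  (\sum_(i < n) (if (K i.+1 < tnth x i)%N then size (elias (tnth x i)) else 0)
     + size (arith x))%N.
Proof.
rewrite size_cat size_flatten sumnE !big_map big_filter big_enum_cond/=.
by rewrite big_mkcond.
Qed.

Section redundancy.
Variables (R : realType) (P : probability paths R).
Hypothesis iidP : stationary_memoryless P.
Let p := first_pmf P.
Let p_ge0 : forall k, 0 <= p k := first_pmf_ge0 P.
Let p_sum1 : (\esum_(k in [set: Nplus]) (p k)%:E = 1)%E := first_pmf_sum1 P.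

(** The ratio (i + 1) r / (N + 1/2) for the class of letter [i], written as a
    sum over all classes of which one term is nonzero, so that the class is fixed
    when the mean of each term is taken. *)
Definition class_fit (i K : nat) (s : seq Nplus) : R :=
  \sum_(j < K.+1) (censor_class K j (nth point s i))%:R *
    (i.+1%:R * letter_prob p (censor_class K j) /
       ((count (censor_class K j) (take i s))%:R + 2^-1)).

Lemma class_fit_ge0 i K s : 0 <= class_fit i K s.
Proof.
apply: sumr_ge0 => j _; rewrite mulr_ge0// divr_ge0 ?addr_ge0 ?invr_ge0//.
by rewrite mulr_ge0// letter_prob_ge0.
Qed.

(** Ideally this mean would be 1.  Each class exceeds its own probability by at
    most [2 / i.+2], whatever that probability is. *)
Lemma class_fit_mean n i K : (i < n)%N ->
  (iid_mean p n (fun s => (class_fit i K s)%:E) <=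
     (1 + 2 * K.+1%:R / i.+2%:R)%:E)%E.
Proof.
move=> lt_in; pose r j := letter_prob p (censor_class K j).
have r_ge0 j : 0 <= r j by exact: letter_prob_ge0.
have r_le1 j : r j <= 1 by exact: letter_prob_le1.
pose phi j c : R := i.+1%:R * r j / (c%:R + 2^-1).
have phi_ge0 j c : 0 <= phi j c.
  by rewrite divr_ge0 ?mulr_ge0 ?addr_ge0 ?invr_ge0.
rewrite (_ : (fun s => _) = (fun s => (\sum_(j < K.+1)
    ((censor_class K j (nth point s i))%:R *
     phi j (count (censor_class K j) (take i s)))%:E)%E)); last first.
  by apply/funext => s; rewrite sumEFin.
rewrite iid_mean_sum//; last by move=> j s; rewrite lee_fin mulr_ge0.
under eq_bigr do rewrite iid_mean_count//.
rewrite sumEFin lee_fin.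
apply: le_trans (_ : \sum_(j < K.+1) (r j + 2 / i.+2%:R) <= _).
  apply: ler_sum => j _.
  rewrite (_ : phi j = fun c => i.+1%:R * r j * (c%:R + 2^-1)^-1)//.
  rewrite binomial_meanZ mulrA mulrCA -expr2.
  by apply: binomial_mean_inv_half; rewrite ?r_ge0 ?r_le1.
rewrite big_split/= sumr_const card_ord -[_ *+ _]mulr_natr mulrAC.
by rewrite lerD2r; exact: sum_censor_class_prob.
Qed.

(** The summand [(ln 2)^-1] is the constant 1 of [ln z <= z - 1] in base 2; it
    is left on this side to keep all the terms nonnegative, and cancels
    against the 1 of [class_fit_mean]. *)
Lemma ideal_step_pointwise K n (x : n.-tuple Nplus) (i : 'I_n) :
  0 < p (tnth x i) ->
  - log2 (coding_prob R K x i (censor K x i)) + (ln 2)^-1 <=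
  - log2 (p (tnth x i)) +
    (ln 2)^-1 * ((K i.+1).+1%:R / 2 / i.+1%:R + class_fit i (K i.+1) x).
Proof.
move=> px0; pose j := censor_letter (K i.+1) (tnth x i).
have lt_jK : (j < (K i.+1).+1)%N.
  by rewrite ltnS /j /censor_letter; case: ifP.
have fitE : class_fit i (K i.+1) x =
    i.+1%:R * letter_prob p (censor_class (K i.+1) j) /
       ((count (censor_class (K i.+1) j) (take i x))%:R + 2^-1).
  rewrite /class_fit (bigD1 (Ordinal lt_jK))//= -tnth_nth.
  rewrite (_ : censor_class _ j _ = true) ?mul1r; last exact: eqxx.
  rewrite big1 ?addr0// => k /eqP nk.
  rewrite (_ : censor_class _ k _ = false) ?mul0r//.
  by apply/negbTE/eqP => e; apply: nk; apply: val_inj; rewrite /= -e.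
have := @ideal_step_le R i (K i.+1)
  (count (censor_class (K i.+1) j) (take i x)) _ _ px0
  (le_letter_prob p_ge0 p_sum1 (A := censor_class (K i.+1) j) (eqxx _)).
rewrite -fitE /coding_prob past_count_censor /log2 -/j.
move/(ler_wpM2l (ltW (x := 0) (y := (ln 2)^-1 : R) _)).
rewrite invr_gt0 ln2_gt0 => /(_ isT).
rewrite !mulrDr mulr1 !mulrN; rewrite !(mulrC (ln 2)^-1).
by rewrite -!mulNr; apply: le_trans; rewrite lexx.
Qed.

Lemma joint_pmfE n (x : n.-tuple Nplus) : joint_pmf P x = word_pmf p x.
Proof. exact: iidP. Qed.

Lemma word_pmf_le1 n (x : n.-tuple Nplus) : word_pmf p x <= 1.
Proof.
rewrite -joint_pmfE -lee_fin /joint_pmf fineK.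
  by rewrite probability_le1//; exact: message_measurable.
by rewrite fin_num_measure//; exact: message_measurable.
Qed.

Lemma word_pmf_letter_gt0 n (x : n.-tuple Nplus) i :
  0 < word_pmf p x -> 0 < p (tnth x i).
Proof.
move=> x0; rewrite lt_def p_ge0 andbT; apply/eqP => pi0.
by move: x0; rewrite /word_pmf (bigD1 i)//= pi0 mul0r ltxx.
Qed.

Lemma entropy_term_ge0 n (x : n.-tuple Nplus) :
  0 <= - (joint_pmf P x * log2 (joint_pmf P x)).
Proof.
rewrite joint_pmfE -mulrN mulr_ge0 ?word_pmf_ge0//.
rewrite oppr_ge0 /log2 pmulr_lle0 ?invr_gt0 ?ln2_gt0//.
by rewrite ln_le0// word_pmf_le1.
Qed.
Lemma log2_word_pmf n (x : n.-tuple Nplus) : 0 < word_pmf p x ->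
  log2 (word_pmf p x) = \sum_(i < n) log2 (p (tnth x i)).
Proof.
move=> x0.
have px0 i := word_pmf_letter_gt0 i x0.
rewrite /log2 -mulr_suml; congr (_ / _).
suff [] : 0 < word_pmf p x /\ ln (word_pmf p x) = \sum_(i < n) ln (p (tnth x i)).
  by [].
apply: (big_ind2 (fun a b => 0 < a /\ ln a = b)) => [|a b c d [a0 <-] [c0 <-]|i _].
- by rewrite ln1.
- by rewrite lnM ?posrE ?mulr_gt0.
- by [].
Qed.


(** The pointwise comparison holds on messages of positive probability.  The
    entropy need not be finite here: if it is infinite the redundancy is minus
    infinity. *)
Lemma expected_redundancy_le (K : nat -> nat) n (elias : Nplus -> seq bool)
    (arith : n.-tuple Nplus -> seq bool) (tail : 'I_n -> R) :
  (forall i : 'I_n, \esum_(k in [set: Nplus]) ((p k)%:E *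
     ((if (K i.+1 < k)%N then size (elias k) else 0%N)%:R)%:E) <=
     (tail i)%:E)%E ->
  (forall x, (size (arith x))%:R <= ideal_length R K x + 1) ->
  (expected_redundancy (censoring_code K elias arith) P <=
    (1 + \sum_(i < n) (tail i +
       (ln 2)^-1 * (5 / 2 * (K i.+1).+1%:R / i.+1%:R)))%:E)%E.
Proof.
move=> tailP arithP.
have il2_ge0 : 0 <= (ln 2)^-1 :> R by rewrite invr_ge0 ltW// ln2_gt0.
pose elias_part i (s : seq Nplus) : R :=
  (if (K i.+1 < nth point s i)%N then size (elias (nth point s i)) else 0%N)%:R.
pose fit_part i s : R :=
  (ln 2)^-1 * ((K i.+1).+1%:R / 2 / i.+1%:R + class_fit i (K i.+1) s).
have elias_ge0 i s : 0 <= elias_part i s by [].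
have fit_ge0 i s : 0 <= fit_part i s.
  by rewrite mulr_ge0// addr_ge0// ?class_fit_ge0// divr_ge0.
pose bound s : R := 1 + \sum_(i < n) (elias_part i s + fit_part i s).
have bound_ge0 s : 0 <= bound s.
  by rewrite addr_ge0// sumr_ge0// => i _; rewrite addr_ge0.
have pointwise (x : n.-tuple Nplus) : 0 < word_pmf p x ->
    (size (censoring_code K elias arith x))%:R + n%:R / ln 2 <=
    bound x - log2 (word_pmf p x).
  move=> x0; rewrite size_censoring_code natrD natr_sum log2_word_pmf//.
  have px0 i := word_pmf_letter_gt0 i x0.
  have := arithP x; rewrite /ideal_length -sumrN => hx.
  have : \sum_(i < n) (- log2 (coding_prob R K x i (censor K x i)) + (ln 2)^-1) <=
         \sum_(i < n) (- log2 (p (tnth x i)) + fit_part i x).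
    by apply: ler_sum => i _; exact: ideal_step_pointwise.
  rewrite !big_split/= sumr_const card_ord -[_ *+ n]mulr_natl => hstep.
  have -> : \sum_(i < n) (if (K i.+1 < tnth x i)%N then size (elias (tnth x i))
      else 0%N)%:R = \sum_(i < n) elias_part i x :> R.
    by apply: eq_bigr => i _; rewrite /elias_part -tnth_nth.
  rewrite /bound big_split/= -sumrN; move: hx hstep.
  set a := \sum_(i < n) - log2 (coding_prob _ _ _ _ _).
  by lra.
have mean_bound : (iid_mean p n (fun s => (bound s)%:E) <=
    (1 + \sum_(i < n) (tail i +
       (ln 2)^-1 * (5 / 2 * (K i.+1).+1%:R / i.+1%:R)))%:E + (n%:R / ln 2)%:E)%E.
  rewrite (_ : (fun s => _) = (fun s => 1 +
     \sum_(i < n) ((elias_part i s)%:E + (fit_part i s)%:E))%E); last first.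
    apply/funext => s; rewrite /bound EFinD -sumEFin.
    by congr (_ + _)%E; apply: eq_bigr => i _; rewrite EFinD.
  rewrite iid_meanD//; last first.
    by move=> s; apply: sume_ge0 => i _; rewrite -EFinD lee_fin addr_ge0.
  rewrite iid_mean_cst// iid_mean_sum//; last first.
    by move=> i s; rewrite -EFinD lee_fin addr_ge0.
  rewrite -EFinD -addrA EFinD leeD2l//.
  have -> : n%:R / ln 2 = \sum_(i < n) (ln 2)^-1 :> R.
    by rewrite sumr_const card_ord mulr_natl.
  rewrite -big_split/= -sumEFin.
  apply: lee_sum => i _.
  rewrite iid_meanD; [|by []| |]; try by move=> s; rewrite lee_fin.
  rewrite -addrA EFinD leeD//.
    apply: le_trans (tailP i); rewrite le_eqVlt; apply/orP; left; apply/eqP.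
    apply: (iid_mean_nth p_ge0 p_sum1 point (n := n) (i := i) (f := fun k =>
      (if (K i.+1 < k)%N then size (elias k) else 0%N)%:R%:E)) => // k.
    by rewrite lee_fin.
  rewrite (_ : (fun s => _) = (fun s => (ln 2)^-1%:E *
     (((K i.+1).+1%:R / 2 / i.+1%:R)%:E + (class_fit i (K i.+1) s)%:E))%E)//.
  have d0 : (0 <= ((K i.+1).+1%:R / 2 / i.+1%:R : R)%:E)%E.
    by rewrite lee_fin !divr_ge0.
  have cf0 s : (0 <= (class_fit i (K i.+1) s)%:E)%E by rewrite lee_fin class_fit_ge0.
  rewrite iid_meanZ//; last by move=> s; rewrite adde_ge0.
  rewrite iid_meanD; [|by []|by []|by []].
  rewrite iid_mean_cst//.
  apply: (@le_trans _ _ ((ln 2)^-1%:E * (((K i.+1).+1%:R / 2 / i.+1%:R)%:E +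
     (1 + 2 * (K i.+1).+1%:R / i.+2%:R)%:E))%E).
    by rewrite lee_wpmul2l ?lee_fin// leeD2l// class_fit_mean.
  rewrite -EFinD -EFinM lee_fin -[X in _ <= _ + X]mulr1 -mulrDr ler_wpM2l//.
  have : 2 * (K i.+1).+1%:R / i.+2%:R <= 2 * (K i.+1).+1%:R / i.+1%:R :> R.
    by rewrite ler_wpM2l// lef_pV2 ?posrE// ler_nat.
  by move: (i.+1%:R^-1) (i.+2%:R^-1) ((K i.+1).+1%:R) => a b c; lra.
rewrite /expected_redundancy.
have -> := expectation_message P (f := fun x =>
  (size (censoring_code K elias arith x))%:R) (fun=> ler0n _ _).
have H0 : (0 <= joint_entropy P n)%E.
  by apply: esum_ge0 => x _; rewrite lee_fin entropy_term_ge0.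
have main : (\esum_(x in [set: n.-tuple Nplus]) ((joint_pmf P x)%:E *
     (size (censoring_code K elias arith x))%:R%:E) + (n%:R / ln 2)%:E <=
     iid_mean p n (fun s => (bound s)%:E) + joint_entropy P n)%E.
  have nl0 : 0 <= n%:R / ln 2 :> R by rewrite divr_ge0// ltW// ln2_gt0.
  rewrite -(@iid_mean_cst _ _ p p_ge0 p_sum1 n (n%:R / ln 2)%:E)//.
  rewrite /iid_mean /joint_entropy -!esumD; first last.
  - by move=> x _; rewrite lee_fin mulr_ge0// word_pmf_ge0.
  - by move=> x _; rewrite lee_fin joint_pmfE mulr_ge0// word_pmf_ge0.
  - by move=> x _; rewrite lee_fin entropy_term_ge0.
  - by move=> x _; rewrite lee_fin mulr_ge0// word_pmf_ge0.
  apply: le_esum => x _; rewrite joint_pmfE -!EFinM -!EFinD lee_fin.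
  rewrite -mulrN -!mulrDr.
  have := word_pmf_ge0 p_ge0 x; rewrite le_eqVlt => /orP[/eqP <-|x0].
    by rewrite !mul0r.
  by rewrite ler_pM2l//; exact: pointwise.
move: main mean_bound H0; move: (joint_entropy P n) => [h||//] main mean_bound _.
  rewrite leeBlDr// -(@leeD2rE _ (n%:R / ln 2)%:E)// (le_trans main)//.
  by rewrite addeAC leeD2r.
by rewrite addeNy leNye.
Qed.

End redundancy.

(** * Power sums and power tails *)

(** Bernoulli's inequality for exponents below 1: concavity of [ln] at
    1 - s u = s (1 - u) + (1 - s) 1. *)
Lemma powR_1B_le (R : realType) (s u : R) : 0 < s <= 1 -> 0 <= u <= 1 ->
  (1 - u) `^ s <= 1 - s * u.
Proof.
move=> /andP[s0 s1] /andP[u0 u1].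
have [->|u_neq1] := eqVneq u 1; first by rewrite subrr powR0 ?gt_eqF//; lra.
have u_lt1 : u < 1 by rewrite lt_neqAle u_neq1.
have v0 : 0 < 1 - s * u by nra.
have w0 : 0 < 1 - u by lra.
rewrite -ler_ln ?posrE ?powR_gt0// ln_powR.
set v := 1 - s * u in v0 *; set w := 1 - u in w0 *.
(* the tangent of ln at v bounds ln w and ln 1, and cancels in the barycentre *)
have h1 := ln_le_subr1 (divr_gt0 w0 v0).
have h2 : - ln v <= v^-1 - 1.
  by rewrite -lnV ?posrE//; apply: ln_le_subr1; rewrite invr_gt0.
rewrite ln_div ?posrE// in h1.
have e : s * (w / v - 1) + (1 - s) * (v^-1 - 1) = 0.
  by rewrite /w /v; field; rewrite gt_eqF.
have h3 := ler_wpM2l (ltW s0) h1.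
have s'0 : 0 <= 1 - s by lra.
have h4 := ler_wpM2l s'0 h2.
rewrite -subr_ge0.
have -> : ln v - s * ln w = - (s * (ln w - ln v)) - ((1 - s) * - ln v) by ring.
by lra.
Qed.

(** Each term is at most (i + 1)^s / s - i^s / s by Bernoulli's inequality, and
    the sum telescopes. *)
Lemma sum_powR_le (R : realType) (s : R) n : 0 < s <= 1 ->
  \sum_(i < n) (i.+1%:R `^ (s - 1)) <= n%:R `^ s / s.
Proof.
move=> s01; have /andP[s0 s1] := s01.
elim: n => [|n IH]; first by rewrite big_ord0 divr_ge0 ?powR_ge0// ltW.
rewrite big_ord_recr/= (le_trans (lerD IH (lexx _)))//.
rewrite -lerBrDl -mulrBl ler_pdivlMr// mulrC.
have x0 : 0 < n.+1%:R :> R by [].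
have -> : n%:R `^ s = n.+1%:R `^ s * (1 - n.+1%:R^-1) `^ s :> R.
  rewrite -powRM//; last by rewrite subr_ge0 invf_le1// ler1n.
  by rewrite mulrBr mulr1 mulfV ?gt_eqF// -(addn1 n) natrD addrK.
have h := @powR_1B_le R s n.+1%:R^-1 s01.
rewrite powRB; last by apply/implyP => _; rewrite gt_eqF.
rewrite powRr1//.
have {h} := h _; rewrite invr_ge0 invf_le1// ler1n ler0n /= => /(_ isT) h.
have := ler_wpM2l (powR_ge0 n.+1%:R s) h.
rewrite mulrBr mulr1.
move: ((1 - _) `^ s) => z.
by move: (n.+1%:R `^ s) (n.+1%:R^-1) => a b; lra.
Qed.

Lemma powRN_le_telescope (R : realType) (beta x : R) : 1 < beta -> 1 < x ->
  (beta - 1) * x `^ (- beta) <= (x - 1) `^ (1 - beta) - x `^ (1 - beta).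
Proof.
move=> b1 x1; have x0 : 0 < x by lra.
have u0 : 0 < x^-1 by rewrite invr_gt0.
have u1 : x^-1 < 1 by rewrite invf_lt1.
have -> : x - 1 = x * (1 - x^-1) by rewrite mulrBr mulr1 mulfV ?gt_eqF.
rewrite powRM ?(ltW x0)//; last by lra.
have -> : x `^ (- beta) = x `^ (1 - beta) * x^-1.
  rewrite -[in X in _ * X](powR_inv1 (ltW x0)) -powRD; last first.
    by apply/implyP => _; rewrite gt_eqF.
  by congr (_ `^ _); ring.
rewrite mulrCA -[X in _ <= _ - X]mulr1 -mulrBr ler_wpM2l ?powR_ge0//.
have w0 : 0 < 1 - x^-1 by lra.
rewrite lerBrDl /powR gt_eqF// (le_trans _ (expR_ge1Dx _))// lerD2l.
have := ln_le_subr1 w0; move: (ln _) => l; nra.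
Qed.

(** The tail beyond [K] of the series of k^(-beta).  The bound is stated at a
    real point [a] below [K.+1], the cutoff before rounding; the
    first term is kept apart because the telescoping bound of a term needs the
    previous integer, and [K] can be 0. *)
Lemma sum_powRN_le (R : realType) (beta a : R) (K m : nat) :
  1 < beta -> 0 < a -> a <= K.+1%:R ->
  \sum_(j < m) (K.+1 + j)%:R `^ (- beta) <=
  a `^ (- beta) + a `^ (1 - beta) / (beta - 1).
Proof.
move=> b1 a0 aK.
have b0 : 0 < beta - 1 by lra.
have le_neg (r : R) : r <= 0 -> K.+1%:R `^ r <= a `^ r.
  move=> r0; rewrite -[r]opprK !(powRN _ (- r)) lef_pV2 ?posrE ?powR_gt0//.
  by rewrite ge0_ler_powR ?nnegrE ?oppr_ge0// ltW.
apply: le_trans (_ : K.+1%:R `^ (- beta) + K.+1%:R `^ (1 - beta) / (beta - 1) <= _).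
  case: m => [|m]; first by rewrite big_ord0 addr_ge0 ?divr_ge0 ?powR_ge0// ltW.
  rewrite big_ord_recl/= addn0 lerD2l.
  suff : \sum_(i < m) (K.+1 + bump 0 i)%:R `^ (- beta) <=
    (K.+1%:R `^ (1 - beta) - (K.+1 + m)%:R `^ (1 - beta)) / (beta - 1) :> R.
    move/le_trans; apply; rewrite ler_wpM2r ?invr_ge0 ?(ltW b0)//.
    by rewrite lerBlDr lerDl powR_ge0.
  elim: m => [|m IH]; first by rewrite big_ord0 addn0 subrr mul0r.
  rewrite big_ord_recr/=; apply: le_trans (lerD IH (lexx _)) _.
  rewrite -lerBrDl -mulrBl ler_pdivlMr// mulrC.
  have x1 : 1 < (K.+1 + m.+1)%:R :> R by rewrite ltr1n addSn addnS.
  apply: le_trans (powRN_le_telescope b1 x1) _.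
  have -> : (K.+1 + m.+1)%:R - 1 = (K.+1 + m)%:R :> R.
    by rewrite addnS -(addn1 (_ + m)) natrD addrK.
  by move: (_ `^ _) (_ `^ _) (_ `^ _) => u v w; lra.
rewrite lerD ?ler_wpM2r ?invr_ge0 ?(ltW b0)//; apply: le_neg; lra.
Qed.

Lemma esum_Nplus_tail (R : realType) (g : nat -> R) (K : nat) (B : R) :
  (forall k, 0 <= g k) ->
  (forall m, \sum_(j < m) g (K.+1 + j)%N <= B) ->
  (\esum_(k in [set: Nplus]) (if (K < k)%N then g k else 0)%:E <= B%:E)%E.
Proof.
move=> g0 gB.
rewrite (_ : (\esum_(k in _) _)%E =
    (\esum_(k in [set k : Nplus | (K < k)%N]) (g k)%:E)%E); last first.
  rewrite [RHS]esum_mkcond; apply: eq_esum => k _.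
  case: ifPn => h; first by rewrite ifT// inE.
  by rewrite ifF//; apply/negbTE; rewrite notin_setE; apply/negP.
pose e (j : nat) : Nplus := @MkNplus (K.+1 + j)%N isT.
rewrite (reindex_esum [set: nat] _ e); last first.
  split=> [j _ /=|j l _ _ /(congr1 nat_of_Nplus)/= /addnI//|k /= Kk].
    by rewrite /e/= addSn ltnS leq_addr.
  by exists (k - K.+1)%N => //; apply: val_inj; rewrite /= subnKC.
rewrite -nneseries_esumT; last by move=> j; rewrite lee_fin.
apply: lime_le; first by apply: is_cvg_nneseries => j _ _; rewrite lee_fin.
by apply: nearW => m; rewrite sumEFin lee_fin big_mkord; exact: gB.
Qed.

Lemma ln2_ge_half (R : realType) : 2^-1 <= ln 2 :> R.
Proof.
have := @ln_le_subr1 R 2^-1; rewrite invr_gt0 lnV ?posrE//.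
by move=> /(_ (ltr0Sn R 1)); lra.
Qed.

(** The coefficient 2 is not sharp: any coefficient below 4 would do for the
    theorem, because the censored part has a factor 4 to spare. *)
Lemma elias_length_le (R : realType) (j : nat) : (0 < j)%N ->
  (elias_length R j)%:R <= 2 * log2 j%:R + 5 :> R.
Proof.
move=> j0; have l2 := ln2_gt0 R; have l2h := ln2_ge_half R.
set y : R := log2 j%:R.
have y0 : 0 <= y by rewrite divr_ge0 ?ln_ge0 ?ler1n// ltW.
have y1 : 0 < (1 + y) / 4 by lra.
(* tangent of ln at 4, using ln 2 >= 1/2 *)
have lny : ln (1 + y) <= (y / 2 + 2) * ln 2.
  have -> : 1 + y = (1 + y) / 4 * 2 ^+ 2 by field.
  rewrite lnM ?posrE ?exprn_gt0// lnXn//.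
  have := ln_le_subr1 y1; rewrite -mulr_natl; nra.
have log_ge0 : 0 <= log2 (1 + y) by rewrite divr_ge0 ?ln_ge0 ?(ltW l2)//; lra.
apply: le_trans (_ : y + 2 * log2 (1 + y) + 1 <= _).
  by rewrite /elias_length -/y truncn_le; lra.
have : log2 (1 + y) <= y / 2 + 2.
  by rewrite /log2 ler_pdivrMr.
lra.
Qed.

(** * Cost of the censored letters under the envelope *)

(** Trades the logarithm of a large letter for a small power of its ratio to
    [a], so that it can be summed against the envelope. *)
Lemma ln_le_powR (R : realType) (delta a x : R) : 0 < delta -> 0 < a -> 0 < x ->
  ln x <= ln a + (x / a) `^ delta / delta.
Proof.
move=> d0 a0 x0; have xa0 : 0 < x / a by rewrite divr_gt0.
have {1}-> : x = x / a * a by rewrite divfK ?gt_eqF.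
rewrite lnM ?posrE// addrC lerD2l ler_pdivlMr// mulrC -ln_powR.
by rewrite (le_trans (ln_le_subr1 (powR_gt0 _ xa0)))// gerBl.
Qed.

Lemma log2_ge0 (R : realType) (x : R) : 1 <= x -> 0 <= log2 x.
Proof. by move=> x1; rewrite divr_ge0 ?ln_ge0 ?ler1n. Qed.

Definition elias_offset (R : realType) (alpha : R) : R :=
  5 + 8 / ((alpha - 1) * ln 2).

(** By [ln_le_powR] with delta = (alpha - 1) / 2 the logarithm of a censored
    letter is [log2 b] plus a power of exponent delta, whose series against
    k^(-alpha) still converges and is of the same order a^(1 - alpha) as the
    tail itself.  Hence the correction is absorbed in a constant offset. *)
Lemma censored_elias_mean_le (R : realType) (C alpha a b : R) (p : Nplus -> R)
    (elias : Nplus -> seq bool) (K : nat) :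
  0 < C -> 1 < alpha -> 0 < a -> a <= b -> 1 <= b -> a <= K.+1%:R ->
  (forall k, 0 <= p k) -> (forall k : Nplus, p k <= C / k%:R `^ alpha) ->
  has_elias_lengths R elias ->
  (\esum_(k in [set: Nplus]) ((p k)%:E *
     (if (K < k)%N then size (elias k) else 0%N)%:R%:E) <=
   (C * (2 * log2 b + elias_offset alpha) *
     (a `^ (- alpha) + a `^ (1 - alpha) / (alpha - 1)))%:E)%E.
Proof.
move=> C0 al1 a0 ab b1 aK p0 pC eliasP.
have l2 := ln2_gt0 R.
pose delta := (alpha - 1) / 2.
have d0 : 0 < delta by rewrite /delta; lra.
pose A := 2 * log2 b + 5; pose D := 2 / (delta * ln 2).
have A0 : 0 <= A by rewrite /A; have := log2_ge0 b1; lra.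
have D0 : 0 <= D by rewrite divr_ge0// mulr_ge0// ltW.
pose g (k : nat) : R :=
  C * (A * k%:R `^ (- alpha) + D * a `^ (- delta) * k%:R `^ (- (1 + delta))).
have g0 k : 0 <= g k.
  apply: mulr_ge0 (ltW C0) (addr_ge0 (mulr_ge0 A0 (powR_ge0 _ _)) _).
  exact: mulr_ge0 (mulr_ge0 D0 (powR_ge0 _ _)) (powR_ge0 _ _).
(* the summable majorant g of a censored letter's expected cost *)
have term (k : Nplus) : p k * (size (elias k))%:R <= g k.
  have k0 : (0 < k)%N by case: k.
  have kR0 : 0 < k%:R :> R by rewrite ltr0n.
  rewrite eliasP; apply: le_trans (ler_wpM2l (p0 k) (elias_length_le R k0)) _.
  have h : 2 * log2 k%:R + 5 <= A + D * (k%:R / a) `^ delta.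
    rewrite /A addrAC lerD2r /D /log2.
    have -> : 2 / (delta * ln 2) * (k%:R / a) `^ delta =
        2 * ((k%:R / a) `^ delta / delta / ln 2) by field; rewrite !gt_eqF.
    rewrite -mulrDr ler_wpM2l// -mulrDl ler_wpM2r ?invr_ge0 ?(ltW l2)//.
    apply: le_trans (ln_le_powR d0 a0 kR0) _.
    by rewrite lerD2r ler_ln ?posrE// (lt_le_trans a0).
  have h0 : 0 <= A + D * (k%:R / a) `^ delta.
    exact: addr_ge0 A0 (mulr_ge0 D0 (powR_ge0 _ _)).
  apply: le_trans (ler_wpM2l (p0 k) h) _.
  apply: le_trans (ler_wpM2r h0 (pC k)) _.
  rewrite /g -[leLHS]mulrA ler_wpM2l ?(ltW C0)// -powRN mulrDr lerD//.
    by rewrite mulrC.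
  have -> : (k%:R / a) `^ delta = k%:R `^ delta * a `^ (- delta).
    rewrite powRM ?invr_ge0 ?(ltW a0) ?(ltW kR0)//.
    by rewrite -(powR_inv1 (ltW a0)) -powRrM mulN1r.
  have -> : k%:R `^ (- (1 + delta)) = k%:R `^ (- alpha) * k%:R `^ delta.
    rewrite -powRD; last by apply/implyP => _; rewrite gt_eqF.
    by congr (_ `^ _); rewrite /delta; field.
  by rewrite le_eqVlt; apply/orP; left; apply/eqP; ring.
apply: (@le_trans _ _ (\esum_(k in [set: Nplus])
    (if (K < k)%N then g k else 0)%:E)%E).
  apply: le_esum => k _; rewrite -EFinM lee_fin; case: ifP => _//.
  by rewrite mulr0.
apply: esum_Nplus_tail => // m.
rewrite -mulr_sumr -mulrA ler_wpM2l ?(ltW C0)// big_split/= -!mulr_sumr.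
have d1 : 1 < 1 + delta by lra.
have S1 := sum_powRN_le m al1 a0 aK.
have S2 := sum_powRN_le m d1 a0 aK.
have Da0 : 0 <= D * a `^ (- delta) by exact: (mulr_ge0 D0 (powR_ge0 _ _)).
apply: le_trans (lerD (ler_wpM2l A0 S1) (ler_wpM2l Da0 S2)) _.
have e1 : a `^ (- alpha) = a `^ (- delta) * a `^ (- (1 + delta)).
  rewrite -powRD; last by apply/implyP => _; rewrite gt_eqF.
  by congr (_ `^ _); rewrite /delta; field.
have e2 : a `^ (1 - alpha) = a `^ (- delta) * a `^ (1 - (1 + delta)).
  rewrite -powRD; last by apply/implyP => _; rewrite gt_eqF.
  by congr (_ `^ _); rewrite /delta; field.
have -> : D * a `^ (- delta) * (a `^ (- (1 + delta)) +
    a `^ (1 - (1 + delta)) / (1 + delta - 1)) =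
    D * a `^ (- alpha) + D * a `^ (1 - alpha) / delta.
  by rewrite e1 e2 (addrAC 1) subrr add0r; ring.
have -> : 2 * log2 b + elias_offset alpha = A + 2 * D.
  rewrite /A /D /elias_offset /delta; field.
  by rewrite !gt_eqF//; lra.
have -> : D * a `^ (1 - alpha) / delta = 2 * D * (a `^ (1 - alpha) / (alpha - 1)).
  by rewrite /delta; field; rewrite gt_eqF//; lra.
have := mulr_ge0 D0 (powR_ge0 a (- alpha)); nra.
Qed.

(** * Asymptotics of the power cutoffs *)

Section asymptotics.
Variables (R : realType) (C alpha : R).
Hypotheses (C_gt0 : 0 < C) (alpha_gt1 : 1 < alpha).
Let lambda := 4 * C / (alpha - 1).
Let s := alpha^-1.

Definition real_cutoff (i : nat) : R := (4 * C * i%:R / (alpha - 1)) `^ alpha^-1.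

Let alpha_gt0 : 0 < alpha. Proof. exact: lt_trans ltr01 alpha_gt1. Qed.
Let s_gt0 : 0 < s. Proof. by rewrite invr_gt0. Qed.
Let s_le1 : s <= 1. Proof. by rewrite invf_le1// ltW. Qed.
Let lambda_gt0 : 0 < lambda.
Proof. by rewrite divr_gt0 ?mulr_gt0// subr_gt0. Qed.

Lemma real_cutoffE i : real_cutoff i = lambda `^ s * i%:R `^ s.
Proof.
rewrite -powRM ?(ltW lambda_gt0)// /real_cutoff; congr (_ `^ _).
by rewrite /lambda mulrAC.
Qed.

Lemma real_cutoff_gt0 i : (0 < i)%N -> 0 < real_cutoff i.
Proof. by move=> i0; rewrite real_cutoffE mulr_gt0 ?powR_gt0 ?ltr0n. Qed.

Lemma real_cutoff_powR i r : real_cutoff i `^ r = (lambda * i%:R) `^ (s * r).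
Proof.
rewrite powRrM real_cutoffE -powRM ?(ltW lambda_gt0)//.
Qed.

Lemma power_cutoff_le i : (power_cutoff C alpha i)%:R <= real_cutoff i.
Proof. by rewrite truncn_le powR_ge0. Qed.

Lemma real_cutoff_lt i : real_cutoff i < (power_cutoff C alpha i).+1%:R.
Proof.
by have /andP[] := truncn_itv (powR_ge0 (4 * C * i%:R / (alpha - 1)) alpha^-1).
Qed.

Lemma invr_le_powR (x : R) : 1 <= x -> x^-1 <= x `^ (s / 2 - 1).
Proof.
move=> x1; have x0 : 0 <= x by lra.
by rewrite -(powR_inv1 x0) ler_powR//; have := s_gt0; lra.
Qed.

(** The choice of lambda shows in the coefficient [A / 4]: it is
    C / (alpha - 1) / lambda.  The terms in 1 / i, which come from rounding and
    from the boundary of the tail sum, are relaxed to a power so that the same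
    summation lemma applies to them. *)
Lemma redundancy_term_le (A c : R) i : 0 <= A -> 0 <= c -> (0 < i)%N ->
  C * A * (real_cutoff i `^ (- alpha) + real_cutoff i `^ (1 - alpha) / (alpha - 1))
    + c * ((power_cutoff C alpha i).+1%:R / i%:R) <=
  (A / 4 + c) * lambda `^ s * i%:R `^ (s - 1) +
    (C * A / lambda + c) * i%:R `^ (s / 2 - 1).
Proof.
move=> A0 c0 i0; have i1 : 1 <= i%:R :> R by rewrite ler1n.
have iR0 : 0 < i%:R :> R by rewrite ltr0n.
have li0 : 0 < lambda * i%:R by rewrite mulr_gt0.
rewrite !real_cutoff_powR.
have -> : s * - alpha = -1 by rewrite /s; field; rewrite gt_eqF.
have -> : s * (1 - alpha) = s - 1 by rewrite /s; field; rewrite gt_eqF.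
rewrite (powR_inv1 (ltW li0)) (powRM _ (ltW lambda_gt0) (ltW iR0)) invfM.
rewrite (powRB (x := lambda)); last by apply/implyP => _; rewrite gt_eqF.
rewrite (powRr1 (ltW lambda_gt0)).
have hi := invr_le_powR i1.
have hK : (power_cutoff C alpha i).+1%:R / i%:R <=
    lambda `^ s * i%:R `^ (s - 1) + i%:R `^ (s / 2 - 1) :> R.
  have -> : i%:R `^ (s - 1) = i%:R `^ s / i%:R :> R.
    rewrite powRB; last by apply/implyP => _; rewrite gt_eqF.
    by rewrite powRr1 ?ltW.
  rewrite mulrA -real_cutoffE -natr1 mulrDl mul1r lerD//.
  by rewrite ler_pM2r ?invr_gt0// power_cutoff_le.
have h1 := ler_wpM2l c0 hK.
have CAl0 := divr_ge0 (mulr_ge0 (ltW C_gt0) A0) (ltW lambda_gt0).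
have h2 := ler_wpM2l CAl0 hi.
have e : C * A * (lambda `^ s / lambda * i%:R `^ (s - 1) / (alpha - 1)) =
    A / 4 * lambda `^ s * i%:R `^ (s - 1).
  have al1 : 0 < alpha - 1 by rewrite subr_gt0.
  by rewrite /lambda; field; rewrite !gt_eqF.
rewrite mulrDr e.
rewrite [C * A * _](_ : _ = C * A / lambda / i%:R); last by ring.
move: h1 h2.
move: (lambda `^ s) (i%:R `^ (s - 1)) (i%:R `^ (s / 2 - 1)) => u v w.
by move: (C * A / lambda) (i%:R^-1) ((power_cutoff _ _ _).+1%:R) => x y z; lra.
Qed.

Lemma redundancy_sum_le (A c : R) n : 0 <= A -> 0 <= c ->
  \sum_(i < n) (C * A * (real_cutoff i.+1 `^ (- alpha) +
       real_cutoff i.+1 `^ (1 - alpha) / (alpha - 1))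
    + c * ((power_cutoff C alpha i.+1).+1%:R / i.+1%:R)) <=
  alpha * (A / 4 + c) * real_cutoff n +
    2 * alpha * (C * A / lambda + c) * n%:R `^ (s / 2).
Proof.
move=> A0 c0.
apply: le_trans.
  by apply: ler_sum => i _; exact: (redundancy_term_le A0 c0 (ltn0Sn i)).
rewrite big_split/= -!mulr_sumr.
have ss1 : 0 < s <= 1 by rewrite s_gt0.
have ss2 : 0 < s / 2 <= 1.
  by rewrite divr_gt0//= ler_pdivrMr// mul1r (le_trans s_le1)// ler1n.
have h1 := sum_powR_le n ss1.
have h2 := sum_powR_le n ss2.
have c1 : 0 <= (A / 4 + c) * lambda `^ s.
  by rewrite mulr_ge0 ?powR_ge0// addr_ge0// divr_ge0.
have c2 : 0 <= C * A / lambda + c.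
  exact: addr_ge0 (divr_ge0 (mulr_ge0 (ltW C_gt0) A0) (ltW lambda_gt0)) c0.
apply: le_trans (lerD (ler_wpM2l c1 h1) (ler_wpM2l c2 h2)) _.
rewrite real_cutoffE le_eqVlt; apply/orP; left; apply/eqP.
have -> : n%:R `^ s / s = alpha * n%:R `^ s by rewrite {2}/s invrK mulrC.
have -> : n%:R `^ (s / 2) / (s / 2) = 2 * alpha * n%:R `^ (s / 2).
  by rewrite invfM invrK {2}/s invrK; ring.
by ring.
Qed.

Lemma near_log2_ge (X : R) : \forall n \near \oo, X <= log2 (n%:R : R).
Proof.
near=> n; have : expR (X * ln 2) <= n%:R :> R.
  by near: n; exact: nbhs_infty_ger.
move=> h; have n0 : 0 < n%:R :> R := lt_le_trans (expR_gt0 _) h.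
by rewrite /log2 ler_pdivlMr ?ln2_gt0// -(expRK (X * ln 2)) ler_ln// posrE expR_gt0.
Unshelve. all: by end_near. Qed.

Lemma near_powR_ge (r X : R) : 0 < r -> \forall n \near \oo, X <= (n%:R : R) `^ r.
Proof.
move=> r0; near=> n.
have n0 : (0 < n)%N by near: n; exact: nbhs_infty_gt.
have : X / (r * ln 2) <= log2 n%:R by near: n; exact: near_log2_ge.
rewrite /log2 ler_pdivlMr ?ln2_gt0// => /(ler_wpM2l (ltW r0)).
have -> : r * (X / (r * ln 2) * ln 2) = X.
  by field; rewrite !gt_eqF ?ln2_gt0.
rewrite /powR gt_eqF ?ltr0n// => h.
by rewrite (le_trans h)// (le_trans _ (expR_ge1Dx _))// lerDr.
Unshelve. all: by end_near. Qed.

(** With u = lambda^s, L = log2 n and h = n^(s/2), the cutoff is u h^2 and the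
    left-hand side is u h^2 L / 2 plus terms of order h^2, L h and 1.  Each of
    the four remainders is made smaller than u h^2 L / 8. *)
Lemma near_redundancy_bound (offset c : R) : 0 <= c ->
  \forall n \near \oo,
    let A := 2 * log2 (real_cutoff n) + offset in
    1 <= real_cutoff n /\
    1 + (alpha * (A / 4 + c) * real_cutoff n +
         2 * alpha * (C * A / lambda + c) * n%:R `^ (s / 2)) <=
    real_cutoff n * log2 n%:R.
Proof.
move=> c0.
pose u := lambda `^ s.
have u0 : 0 < u by exact: powR_gt0.
pose c' := 2 * log2 u + offset.
pose m1 := `|alpha * c'| / 4 + alpha * c.
pose m2 := C / lambda.
pose m3 := 2 * m2 * `|alpha * c'| + 2 * alpha * c.
have m2_ge0 : 0 <= m2 by exact: divr_ge0 (ltW C_gt0) (ltW lambda_gt0).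
have s2 : 0 < s / 2 by rewrite divr_gt0.
near=> n.
have n0 : (0 < n)%N by near: n; exact: nbhs_infty_gt.
have nR0 : 0 < n%:R :> R by rewrite ltr0n.
have L1 : 1 <= log2 n%:R :> R by near: n; exact: near_log2_ge.
have Lm1 : 8 * m1 <= log2 n%:R by near: n; exact: near_log2_ge.
have h1 : 1 <= n%:R `^ (s / 2) :> R by near: n; exact: near_powR_ge.
have hu (x : R) : x / u <= n%:R `^ (s / 2) -> x <= u * n%:R `^ (s / 2).
  by rewrite ler_pdivrMr// mulrC.
have uh8 : 8 <= u * n%:R `^ (s / 2) by apply: hu; near: n; exact: near_powR_ge.
have uhm2 : 32 * m2 <= u * n%:R `^ (s / 2) by apply: hu; near: n; exact: near_powR_ge.
have uhm3 : 8 * m3 <= u * n%:R `^ (s / 2) by apply: hu; near: n; exact: near_powR_ge.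
have aE : real_cutoff n = u * (n%:R `^ (s / 2)) ^+ 2.
  rewrite real_cutoffE expr2 -powRD; last by apply/implyP => _; rewrite gt_eqF.
  by congr (_ * _ `^ _); field.
have logaE : log2 (real_cutoff n) = log2 u + s * log2 n%:R.
  rewrite real_cutoffE /log2 lnM ?posrE ?powR_gt0// (ln_powR n%:R) mulrDl.
  by rewrite mulrA.
rewrite /= logaE aE.
have alsE : alpha * s = 1 by rewrite /s mulfV// gt_eqF.
move: (log2 n%:R) (n%:R `^ (s / 2)) L1 Lm1 h1 uh8 uhm2 uhm3 {hu aE logaE}.
move=> L h L1 Lm1 h1 uh8 uhm2 uhm3.
have h0 : 0 <= h by exact: le_trans ler01 h1.
have hh : u * h <= u * h ^+ 2 by rewrite ler_pM2l// expr2 ler_peMl.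
have a8 : 8 <= u * h ^+ 2 by exact: le_trans uh8 hh.
split; first by apply: le_trans a8; rewrite ler1n.
have abs_c' := ler_norm (alpha * c').
rewrite [leLHS](_ : _ = 1 + (L / 2 + (alpha * c' / 4 + alpha * c)) * (u * h ^+ 2) +
    (4 * m2 * L + (2 * m2 * (alpha * c') + 2 * alpha * c)) * h); last first.
  transitivity (1 + (alpha * s * L / 2 + (alpha * c' / 4 + alpha * c)) * (u * h ^+ 2) +
    (4 * m2 * (alpha * s) * L + (2 * m2 * (alpha * c') + 2 * alpha * c)) * h).
    by rewrite /m2 /c'; field; rewrite gt_eqF.
  by rewrite alsE; ring.
have t1 : (alpha * c' / 4 + alpha * c) * (u * h ^+ 2) <= L / 8 * (u * h ^+ 2).
  rewrite ler_wpM2r//; first by exact: le_trans _ a8.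
  have : alpha * c' / 4 + alpha * c <= m1 by rewrite lerD2r ler_wpM2r.
  by move=> ?; lra.
have L0 : 0 <= L by exact: le_trans ler01 L1.
have Lh0 : 0 <= L * h by exact: mulr_ge0.
have t2 : 4 * m2 * L * h <= L / 8 * (u * h ^+ 2).
  have := ler_wpM2r Lh0 uhm2; rewrite expr2.
  by move: (m2) => m2'; lra.
have t3 : (2 * m2 * (alpha * c') + 2 * alpha * c) * h <= L / 8 * (u * h ^+ 2).
  apply: le_trans (_ : m3 * h <= _).
    by rewrite ler_wpM2r// lerD2r ler_wpM2l// mulr_ge0.
  have := ler_wpM2r h0 uhm3; have := ler_wpM2r (le_trans (ler0n _ 8) a8) L1.
  by rewrite mul1r expr2; move: (m3) => m3'; lra.
have t4 : 1 <= L / 8 * (u * h ^+ 2).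
  have := ler_wpM2r (le_trans (ler0n _ 8) a8) L1; rewrite mul1r; lra.
rewrite !mulrDl in t1 t3 *.
by move: t1 t2 t3 t4; rewrite !mulrDl; lra.
Unshelve. all: by end_near. Qed.

End asymptotics.

(** * Redundancy over the power envelope class *)

Theorem theorem8 (R : realType) (C alpha : R) (C_gt0 : 0 < C)
    (alpha_gt1 : 1 < alpha)
    (elias : Nplus -> seq bool) (elias_len : has_elias_lengths R elias)
    (arith : forall n : nat, n.-tuple Nplus -> seq bool)
    (arith_len : has_arithmetic_lengths R (power_cutoff C alpha) arith) :
  exists2 eps : nat -> R, eps @ \oo --> (0 : R) &
    \forall n \near \oo,
      (class_redundancy
         (censoring_code (power_cutoff C alpha) elias (arith n))
         (power_envelope_class C alpha)
       <= ((4 * C * n%:R / (alpha - 1)) `^ alpha^-1 * log2 n%:R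
             * (1 + eps n))%:E)%E.
Proof.
exists (fun=> 0); first exact: cvg_cst.
have al0 : 0 < alpha - 1 by rewrite subr_gt0.
have offset0 : 0 <= elias_offset alpha.
  by rewrite addr_ge0// divr_ge0// mulr_ge0// ltW// ln2_gt0.
pose c : R := (ln 2)^-1 * (5 / 2).
have c0 : 0 <= c by rewrite mulr_ge0// invr_ge0 ltW// ln2_gt0.
near=> n.
have [a1 bound] : let A := 2 * log2 (real_cutoff C alpha n) + elias_offset alpha in
    1 <= real_cutoff C alpha n /\
    1 + (alpha * (A / 4 + c) * real_cutoff C alpha n +
         2 * alpha * (C * A / (4 * C / (alpha - 1)) + c) * n%:R `^ (alpha^-1 / 2)) <=
    real_cutoff C alpha n * log2 n%:R.
  by near: n; exact: near_redundancy_bound.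
set A := 2 * log2 _ + _ in bound.
have A0 : 0 <= A by rewrite addr_ge0// mulr_ge0// log2_ge0.
rewrite addr0 mulr1; apply: ge_ereal_sup => _ [P [iidP envP] <-].
pose tail (i : 'I_n) : R := C * A * (real_cutoff C alpha i.+1 `^ (- alpha) +
  real_cutoff C alpha i.+1 `^ (1 - alpha) / (alpha - 1)).
apply: le_trans (expected_redundancy_le (tail := tail) iidP _ _) _.
- move=> i; apply: (censored_elias_mean_le (a := real_cutoff C alpha i.+1)) => //.
  + exact: real_cutoff_gt0.
  + rewrite !real_cutoffE// ler_wpM2l ?powR_ge0// ge0_ler_powR ?nnegrE//.
      by rewrite invr_ge0 ltW// (lt_trans ltr01).
    by rewrite ler_nat.
  + exact/ltW/real_cutoff_lt.
  + exact: first_pmf_ge0.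
  + by move=> k; rewrite (le_trans (envP k))// ge_min lexx orbT.
- move=> x; have := arith_len n x; rewrite ltr_norml => /andP[_ /ltW].
  by rewrite lerBlDl addrC.
rewrite lee_fin; apply: (le_trans _ bound); rewrite lerD2l.
apply: (le_trans _ (redundancy_sum_le C_gt0 alpha_gt1 n A0 c0)).
by apply: ler_sum => i _; rewrite /tail lerD2l /c !mulrA.
Unshelve. all: by end_near. Qed.
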